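(* Let $(X,d)$ be a Hadamard space and let $\phi:X\to(-\infty,+\infty]$ be a convex lower-semicontinuous function with gradient flow semigroup $(S_t)_{t\geq0}$. Let $y\in\operatorname{argmin}\phi$, $x\in\mathrm{dom}\,\phi$ and let $b\in\mathbb{N}$ with $d(x,y)\leq b$. Let $X_0:=\overline{B}_b(y)\cap\overline{\mathrm{dom}\,\phi}$ and assume that $\gamma$ is a modulus of total boundedness for $X_0$. Then for all $\varepsilon>0$ and all nondecreasing $f:\mathbb{N}\to\mathbb{N}$: \[ \exists n\leq\Delta(\varepsilon,f)\ \forall s,t\in[n,n+f(n)]\ \left(d(S_t(x),S_s(x))\leq\varepsilon\right), \] where $\Delta(\varepsilon,f):=\Delta(\gamma(\varepsilon/\sqrt{12})+1,\varepsilon,f)+1$ with $\Delta(0,\varepsilon,f):=0$ and, for $j\geq0$, \[ \Delta(j+1,\varepsilon,f):=\left\lceil24b^2\left(f(\Delta(j,\varepsilon,f)+1)+1\right)/\varepsilon^2\right\rceil. \]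
   Context: $\mathbb{N}$ contains $0$. A Hadamard space is a complete geodesic metric space of nonpositive curvature in the sense of Alexandrov (complete CAT(0) space). $\mathrm{dom}\,\phi:=\{x\in X\mid\phi(x)<+\infty\}$; $\overline{B}_b(y)$ is the closed ball. The resolvent of $\phi$ is $J_t(x):=\operatorname{argmin}_{u\in X}\left(\phi(u)+\frac{1}{2t}d^2(x,u)\right)$ for $t>0$ and $J_0(x):=x$; the gradient flow semigroup is $S_t(x):=\lim_{n\to\infty}(J_{t/n})^{(n)}(x)$ for $t\geq0$, $x\in\overline{\mathrm{dom}\,\phi}$, where $(\cdot)^{(n)}$ denotes $n$-fold iteration (this limit exists). A function $\gamma:(0,\infty)\to\mathbb{N}$ is a modulus of total boundedness for a nonempty set $A\subseteq X$ if for any $\varepsilon>0$ and any sequence $(x_k)_{k\in\mathbb{N}}$ in $A$ there are $0\leq i<j\leq\gamma(\varepsilon)$ with $d(x_i,x_j)\leq\varepsilon$. *)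

(* Defs.v *)
From HB Require Import structures.
From mathcomp Require Import all_boot all_order all_algebra.
From mathcomp Require Import all_classical all_reals all_analysis.

Set Implicit Arguments.
Unset Strict Implicit.
Unset Printing Implicit Defensive.

Import Order.TTheory GRing.Theory Num.Theory.
Import numFieldNormedType.Exports.

Local Open Scope classical_set_scope.
Local Open Scope ring_scope.

#[short(type="completeMetricType")]
HB.structure Definition CompleteMetric (R : numDomainType) :=
  {T of CompletePseudoMetric R T & Metric R T}.

Section hadamard.
Context {R : realType} {X : metricType R}.

(* Geodesics are parametrized proportionally to arc length on [0, 1]; the values
   of c outside [0, 1] are irrelevant. *)
Definition geodesic (x y : X) (c : R -> X) : Prop :=
  [/\ c 0 = x, c 1 = y &
      forall s t : R, 0 <= s <= 1 -> 0 <= t <= 1 ->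
        mdist (c s) (c t) = `|s - t| * mdist x y].

(* The library norm on 'rV[R]_2 is the sup norm, hence this definition. *)
Definition eucl_dist (p q : 'rV[R]_2) : R :=
  Num.sqrt (\sum_i (p 0 i - q 0 i) ^+ 2).

(* (p, q, r) is a comparison triangle in the Euclidean plane for (x, y, z). *)
Definition comparison_triangle (x y z : X) (p q r : 'rV[R]_2) : Prop :=
  [/\ eucl_dist p q = mdist x y, eucl_dist p r = mdist x z &
      eucl_dist q r = mdist y z].

End hadamard.

Definition geodesic_space (R : realType) (X : metricType R) : Prop :=
  forall x y : X, exists c, geodesic x y c.

(* Distances in geodesic triangles are at most the Euclidean distances between
   the comparison points. Any two distinct sides of a triangle share a vertex,
   here x, and two points on the same side satisfy the inequality trivially. In
   a geodesic space the third side always exists and needs no mention. *)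
Definition cat0 (R : realType) (X : metricType R) : Prop :=
  forall (x y z : X) (c c' : R -> X) (p q r : 'rV[R]_2),
    geodesic x y c -> geodesic x z c' -> comparison_triangle x y z p q r ->
    forall s t : R, 0 <= s <= 1 -> 0 <= t <= 1 ->
      mdist (c s) (c' t) <=
        eucl_dist ((1 - s) *: p + s *: q) ((1 - t) *: p + t *: r).

Definition hadamard (R : realType) (X : completeMetricType R) : Prop :=
  geodesic_space X /\ cat0 X.

Section convex_functions.
Context {R : realType} {X : metricType R}.
Local Open Scope ereal_scope.

Definition dom (phi : X -> \bar R) : set X := [set x | phi x < +oo].

Definition argmin (phi : X -> \bar R) : set X :=
  [set u | forall v, phi u <= phi v].

Definition geodesically_convex (phi : X -> \bar R) : Prop :=
  forall (x y : X) (c : R -> X), geodesic x y c ->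
    forall t : R, (0 <= t <= 1)%R ->
      phi (c t) <= (1 - t)%:E * phi x + t%:E * phi y.

End convex_functions.

(* The library's closed_ball is the closure of the open ball, which is a
   different set in general (for instance when r = 0). *)
Definition metric_closed_ball (R : realType) (X : metricType R)
    (y : X) (r : R) : set X :=
  [set z | mdist y z <= r].

Section gradient_flow.
Context {R : realType} {X : completeMetricType R}.

(* Only meant for 0 <= t. *)
Definition resolvent (phi : X -> \bar R) (t : R) (x : X) : X :=
  if 0 < t then
    get (argmin (fun u => (phi u + ((2 * t)^-1 * mdist x u ^+ 2)%:E)%E))
  else x.

(* Only meant for 0 <= t and x in the closure of the domain of phi. The term
   n = 0 of the sequence is irrelevant. *)
Definition gradient_flow (phi : X -> \bar R) (t : R) (x : X) : X :=
  lim ((fun n : nat => iter n (resolvent phi (t / n%:R)) x) @ \oo).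

End gradient_flow.

(* The values of gamma outside ]0, +oo[ are irrelevant. *)
Definition modulus_of_total_boundedness (R : realType) (X : metricType R)
    (A : set X) (gamma : R -> nat) : Prop :=
  forall (eps : R) (u : nat -> X), 0 < eps -> (forall k, A (u k)) ->
    exists i j : nat,
      [/\ (i < j)%N, (j <= gamma eps)%N & mdist (u i) (u j) <= eps].

(* The ceiling is applied to a nonnegative number, so the absolute value only
   converts it from int to nat. *)
Fixpoint Delta_rec (R : realType) (b : nat) (eps : R) (f : nat -> nat)
    (j : nat) : nat :=
  if j is i.+1 then
    `|Num.ceil (24 * b%:R ^+ 2 * (f (Delta_rec b eps f i + 1) + 1)%:R
                / eps ^+ 2)|%N
  else 0%N.

Definition Delta (R : realType) (b : nat) (gamma : R -> nat) (eps : R)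
    (f : nat -> nat) : nat :=
  (Delta_rec b eps f (gamma (eps / Num.sqrt 12) + 1) + 1)%N.

(* Main.v *)
Require Import Defs.
From mathcomp Require Import all_boot all_order all_algebra.
From mathcomp Require Import all_classical all_reals all_analysis.
From mathcomp Require Import ring lra.

Set Implicit Arguments.
Unset Strict Implicit.
Unset Printing Implicit Defensive.

Import Order.TTheory GRing.Theory Num.Theory.
Import numFieldNormedType.Exports.

Local Open Scope classical_set_scope.
Local Open Scope ring_scope.

(** Write $d$ for the distance, $J_h$ for the resolvent of $\phi$ and
    $S_t$ for the gradient flow. Nonpositive curvature makes the function
    minimized by $J_h$ strongly convex along geodesics, so that every minimizer
    $w = J_h x$ satisfies the discrete evolution variational inequality
      $d^2(w,v) + d^2(x,w) + 2h(\phi(w) - \phi(v)) \le d^2(x,v)$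
    for all $v$ in the domain ([resolvent_evi]). Everything about the flow is
    extracted from this inequality.

    Convergence of the resolvent iterates ([kobayashi]). Let $u_i$ and $v_j$ be
    the iterates of $J_h$ and $J_k$ from $x$, and $D_{i,j} = d^2(u_i,v_j)$.
    Testing the inequality for $u_{i+1}$ with $v_{j+1}$ and the one for
    $v_{j+1}$ with $u_{i+1}$, the convex combination with weights $k/(h+k)$ and
    $h/(h+k)$ cancels the values of $\phi$ and gives
      $D_{i+1,j+1} \le k/(h+k) D_{i,j+1} + h/(h+k) D_{i+1,j}$.
    The function $G_{i,j} = (ih-jk)^2 + ih^2 + jk^2$ solves this recursion with
    equality, as do the constants; comparing boundary values yields
    $D_{i,j} \le (\phi(x) - \min\phi)(G_{i,j}/c + c)$ for every $c > 0$.
    Hence $J_{h_n}^{N_n} x$ tends to $S_t x$ as soon as $h_n \to 0$ and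
    $N_n h_n \to t$ ([gradient_flow_cvg]); this freedom in the choice of the
    step sizes makes it possible to compare two times $s \le t$ along a single
    discrete trajectory.

    Passing to the limit, with $y$ a minimizer of $\phi$,
      $d^2(S_t x, v) \le d^2(S_s x, v) + 2(t-s)(\phi(v) - \phi(y))$ and
      $\phi(S_t x) - \phi(y) \le d^2(x,y)/(2t)$
    ([gradient_flow_evi], [gradient_flow_energy]).

    Metastability. Put $n_k = \Delta(k) + 1$. Total boundedness applied to the
    sequence $S_{n_k} x$ gives $i < j$ with $d(S_{n_i} x, S_{n_j} x)$ at most
    $\varepsilon/\sqrt{12}$. The point $z = S_{n_j} x$ is then almost fixed for
    the rest of the interval $[n_i, n_i + f(n_i)]$: the first estimate with
    $v = z$ and $s = n_i$ shows that $d^2(S_t x, z)$ exceeds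
    $\varepsilon^2/12$ by at most
    $2 f(n_i) (\phi(z) - \phi(y)) \le f(n_i) b^2 / n_j$, and $n_j$ is at
    least $\Delta(i+1)$, which is chosen to make this at most
    $\varepsilon^2/24$. So all $S_t x$ with $t$ in the interval are within
    $\varepsilon/2$ of $z$. *)

(** * The comparison plane and the inequality of Bruhat and Tits *)

Section plane.
Context {R : realType}.
Implicit Types p q r : 'rV[R]_2.

Lemma sqr_eucl_dist p q :
  eucl_dist p q ^+ 2 = (p 0 0 - q 0 0) ^+ 2 + (p 0 1 - q 0 1) ^+ 2.
Proof.
rewrite sqr_sqrtr ?sumr_ge0// => [|i _]; last exact: sqr_ge0.
rewrite !big_ord_recl big_ord0 addr0.
by have -> : lift ord0 ord0 = 1 :> 'I_2 by apply/val_inj.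
Qed.

Lemma eucl_dist_ge0 p q : 0 <= eucl_dist p q.
Proof. exact: sqrtr_ge0. Qed.

(** In the plane, the defect of convexity of the squared distance to a point
    is exactly $t(1-t)$ times the squared length of the segment; comparison
    transports the inequality $\le$ to the space. *)
Lemma sqr_eucl_dist_segment p q r t :
  eucl_dist q ((1 - t) *: p + t *: r) ^+ 2 =
    (1 - t) * eucl_dist p q ^+ 2 + t * eucl_dist q r ^+ 2
    - t * (1 - t) * eucl_dist p r ^+ 2.
Proof. rewrite !sqr_eucl_dist !mxE; ring. Qed.

(** The triangle is placed with its first vertex at the origin and its second
    one on the first axis; the law of cosines then gives the abscissa of the
    third vertex, and the triangle inequalities say that this abscissa does not
    exceed the prescribed distance to the origin. *)
Lemma plane_triangle (a b e : R) :
  0 <= a -> 0 <= b -> 0 <= e -> a <= b + e -> b <= a + e -> e <= a + b ->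
  exists p q r : 'rV[R]_2,
    [/\ eucl_dist p q = a, eucl_dist p r = b & eucl_dist q r = e].
Proof.
move=> a0 b0 e0 abe bae eab.
pose pt (u v : R) : 'rV[R]_2 := \row_j (if j == 0 then u else v).
suff [r1 [r2 [Hb He]]] : exists r1 r2 : R,
    r1 ^+ 2 + r2 ^+ 2 = b ^+ 2 /\ (r1 - a) ^+ 2 + r2 ^+ 2 = e ^+ 2.
  exists (pt 0 0), (pt a 0), (pt r1 r2).
  split; apply: (@pexpIrn _ 2); rewrite ?nnegrE ?eucl_dist_ge0//;
    rewrite sqr_eucl_dist !mxE /=.
  - ring.
  - rewrite -Hb; ring.
  - rewrite -He; ring.
have [a_eq0|an0] := eqVneq a 0.
  have e_eqb : e = b by lra.
  by exists b, 0; rewrite a_eq0 e_eqb; split; ring.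
have agt0 : 0 < a by rewrite lt_def an0.
pose r1 := (a ^+ 2 + b ^+ 2 - e ^+ 2) / (2 * a).
have r1E : 2 * a * r1 = a ^+ 2 + b ^+ 2 - e ^+ 2 by rewrite /r1; field.
exists r1, (Num.sqrt (b ^+ 2 - r1 ^+ 2)).
have r1b : r1 ^+ 2 <= b ^+ 2.
  rewrite -(ler_pM2l (_ : 0 < 4 * a ^+ 2)); last first.
    by rewrite mulr_gt0// exprn_gt0.
  have -> : 4 * a ^+ 2 * r1 ^+ 2 = (2 * a * r1) ^+ 2 by ring.
  rewrite r1E -subr_ge0.
  (* Heron's factorization *)
  have -> : 4 * a ^+ 2 * b ^+ 2 - (a ^+ 2 + b ^+ 2 - e ^+ 2) ^+ 2 =
    ((a + b + e) * (a + b - e)) * ((e + a - b) * (e + b - a)) by ring.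
  by rewrite !mulr_ge0//; lra.
rewrite sqr_sqrtr ?subr_ge0//; split; first ring.
have -> : (r1 - a) ^+ 2 + (b ^+ 2 - r1 ^+ 2) = a ^+ 2 + b ^+ 2 - 2 * a * r1
  by ring.
by rewrite r1E; ring.
Qed.

End plane.

Section cat0_space.
Context {R : realType} {X : metricType R}.
Context (geodX : geodesic_space X) (cat0X : cat0 X).

(** The curvature condition enters the rest of the proof only through this
    inequality of Bruhat and Tits: the squared distance to a point is strongly
    convex along geodesics. It is the comparison inequality for the vertex $w$
    and a point of the opposite side of a triangle, the comparison distance
    being given by [sqr_eucl_dist_segment]. *)
Lemma cat0_sqr_mdist (w u v : X) (c : R -> X) (t : R) :
  geodesic u v c -> 0 <= t <= 1 ->
  mdist w (c t) ^+ 2 <= (1 - t) * mdist w u ^+ 2 + t * mdist w v ^+ 2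
    - t * (1 - t) * mdist u v ^+ 2.
Proof.
move=> gc t01; have [c' gc'] := geodX u w.
have [p [q [r [pq pr qr]]]] := @plane_triangle R (mdist u w) (mdist u v)
  (mdist w v) (mdist_ge0 _ _) (mdist_ge0 _ _) (mdist_ge0 _ _)
  ltac:(by rewrite (metric_sym w); exact: metric_triangle)
  ltac:(exact: metric_triangle)
  ltac:(by rewrite (metric_sym u w); exact: metric_triangle).
have := cat0X gc' gc (And3 pq pr qr) (_ : 0 <= 1 <= 1) t01.
have [_ c'1 _] := gc'; rewrite c'1 => /(_ _); rewrite lexx ler01 => /(_ isT).
rewrite subrr scale0r add0r scale1r => h.
rewrite (metric_sym w u) -pq -pr -qr -sqr_eucl_dist_segment.
by rewrite ler_sqr// nnegrE ?mdist_ge0 ?eucl_dist_ge0.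
Qed.

End cat0_space.

(** * Limits in metric spaces *)

Section metric_limits.
Context {R : realType} {X : completeMetricType R}.
Implicit Types (u : nat -> X) (l z : X).

Lemma sqr_mdist_cvg u l :
  (forall e : R, 0 < e -> \forall n \near \oo, mdist (u n) l ^+ 2 < e) ->
  u @ \oo --> l.
Proof.
move=> ul; apply/metricType_numDomainType.cvgrPdist_lt => e e0.
apply: filterS (ul (e ^+ 2) _) => [n|]; last by rewrite exprn_gt0.
by rewrite ltr_sqr ?nnegrE ?mdist_ge0 ?(ltW e0)// metric_sym.
Qed.

Lemma sqr_mdist_cauchy_cvg u :
  (forall e : R, 0 < e -> exists N, forall m n, (N <= m)%N -> (N <= n)%N ->
     mdist (u m) (u n) ^+ 2 < e) ->
  exists l : X, u @ \oo --> l.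
Proof.
move=> uC; apply/cvg_ex; apply: cauchy_cvg; apply/cauchyP => e e0.
have [|N hN] := uC (e ^+ 2); first by rewrite exprn_gt0.
exists (u N); near_simpl; exists N => // n /= Nn.
rewrite -metricType_numDomainType.ball_mdistE /=.
by rewrite -ltr_sqr ?nnegrE ?mdist_ge0 ?(ltW e0)//; exact: hN.
Qed.

Lemma cvg_sqr_mdist u l z :
  u @ \oo --> l -> mdist (u n) z ^+ 2 @[n --> \oo] --> mdist l z ^+ 2.
Proof.
move=> ul.
suff h : mdist (u n) z @[n --> \oo] --> mdist l z.
  exact: (cvg_comp _ _ h (@exprn_continuous _ 2 _)).
apply/cvgrPdist_lt => e e0.
have ue : \forall n \near \oo, mdist l (u n) < e.
  by move/metricType_numDomainType.cvgrPdist_lt : ul => /(_ _ e0).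
apply: filterS ue => n.
apply: le_lt_trans; rewrite ler_norml.
have := metric_triangle l (u n) z; have := metric_triangle (u n) l z.
rewrite (metric_sym (u n) l); lra.
Qed.

Lemma lower_semicontinuous_cvg_le (phi : X -> \bar R) u l (a : nat -> R)
    (b : R) :
  lower_semicontinuous phi -> u @ \oo --> l -> a @ \oo --> b ->
  (\forall n \near \oo, (phi (u n) <= (a n)%:E)%E) -> (phi l <= b%:E)%E.
Proof.
move=> lsc ul ab ua; rewrite leNgt; apply/negP => bl.
have [c bc cl] : exists2 c : R, b < c & (c%:E < phi l)%E.
  case: (phi l) bl => [r| |]//; last by exists (b + 1); rewrite ?ltrDl ?ltry.
  by rewrite lte_fin => br; exists ((b + r) / 2); rewrite ?lte_fin; lra.
have [V lV Vc] := lsc _ _ cl.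
have VN : \forall n \near \oo, V (u n) by exact: ul.
have aN : \forall n \near \oo, a n < c by exact: (cvgr_lt _ ab).
have [n [[Vn an] un]] := filter_ex (filterI (filterI VN aN) ua).
have := lt_le_trans (Vc _ Vn) un; rewrite lte_fin => /lt_trans /(_ an).
by rewrite ltxx.
Qed.

End metric_limits.

(** * Resolvents and the discrete evolution variational inequality *)

Section resolvents.
Context {R : realType} {X : completeMetricType R} (hX : hadamard X).
Context (phi : X -> \bar R) (phi_gtNy : forall z, (-oo < phi z)%E).
Context (phi_convex : geodesically_convex phi).
Context (phi_lsc : lower_semicontinuous phi).
Context (y : X) (hy : argmin phi y) (dom_y : dom phi y).

Lemma fine_domK u : dom phi u -> (fine (phi u))%:E = phi u.
Proof. by move=> hu; rewrite fineK// fin_numElt phi_gtNy. Qed.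

Lemma dom_le_fin u (r : R) : (phi u <= r%:E)%E ->
  dom phi u /\ fine (phi u) <= r.
Proof.
move=> ur; have du : dom phi u by exact: le_lt_trans ur (ltry _).
by split=> //; rewrite -lee_fin fine_domK.
Qed.

Lemma argmin_le_fine v : dom phi v -> fine (phi y) <= fine (phi v).
Proof. by move=> dv; rewrite -lee_fin !fine_domK//; exact: hy. Qed.

Lemma convex_fine u v c t : geodesic u v c -> dom phi u -> dom phi v ->
  0 <= t <= 1 -> dom phi (c t) /\
  fine (phi (c t)) <= (1 - t) * fine (phi u) + t * fine (phi v).
Proof.
move=> guv du dv t01; apply: dom_le_fin.
by have := phi_convex guv t01; rewrite -(fine_domK du) -(fine_domK dv).
Qed.

Definition prox_cost (h : R) (x u : X) :=
  fine (phi u) + (2 * h)^-1 * mdist x u ^+ 2.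

Lemma prox_cost_geodesic (h : R) (x u v : X) (c : R -> X) (t : R) :
  0 < h -> geodesic u v c -> dom phi u -> dom phi v -> 0 <= t <= 1 ->
  prox_cost h x (c t) <= (1 - t) * prox_cost h x u + t * prox_cost h x v
    - t * (1 - t) * ((2 * h)^-1 * mdist u v ^+ 2).
Proof.
move=> h0 guv du dv t01; rewrite /prox_cost.
have [_ cv] := convex_fine guv du dv t01.
have := cat0_sqr_mdist hX.1 hX.2 x guv t01.
rewrite -(ler_pM2l (_ : 0 < (2 * h)^-1)) ?invr_gt0 ?mulr_gt0//.
set k := (2 * h)^-1 => kd.
rewrite (le_trans (lerD cv kd))// le_eqVlt; apply/orP; left; apply/eqP; ring.
Qed.

(** Strong convexity forces minimizing sequences to be Cauchy: the value at a
    midpoint is at least the infimum, which bounds the squared distance of two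
    points by their excess over the infimum. Lower semicontinuity then makes the
    limit a minimizer. *)
Lemma argmin_prox_exists (h : R) (x : X) : 0 < h ->
  exists u, argmin (fun u => phi u + ((2 * h)^-1 * mdist x u ^+ 2)%:E)%E u.
Proof.
move=> h0; have k0 : 0 < (2 * h)^-1 by rewrite invr_gt0 mulr_gt0.
pose E := [set prox_cost h x u | u in dom phi].
have infE : has_inf E.
  split; first by exists (prox_cost h x y), y.
  exists (fine (phi y)) => _ [u du <-]; rewrite /prox_cost.
  by rewrite ler_wpDr ?argmin_le_fine// mulr_ge0 ?sqr_ge0// ltW.
pose m := inf E.
have m_le v : dom phi v -> m <= prox_cost h x v.
  by move=> dv; apply: ge_inf; [exact: infE.2 | exists v].
have [u hu] : {u : nat -> X & forall n, dom phi (u n) /\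
    prox_cost h x (u n) < m + harmonic n}.
  apply: (@choice _ _
    (fun n v => dom phi v /\ prox_cost h x v < m + harmonic n)).
  move=> n; have [_ [v dv <-] hv] := inf_adherent (harmonic_gt0 n) infE.
  by exists v.
have u_near v w : dom phi v -> dom phi w ->
    mdist v w ^+ 2 <= 4 * h * (prox_cost h x v + prox_cost h x w - 2 * m).
  move=> dv dw; have [c gc] := hX.1 v w.
  have half : 0 <= (2^-1 : R) <= 1 by apply/andP; split; lra.
  have := prox_cost_geodesic x h0 gc dv dw half.
  have := m_le _ (convex_fine gc dv dw half).1.
  set p := prox_cost h x _; set q := prox_cost h x v; set r := prox_cost h x w.
  move=> mp pq.
  have -> : mdist v w ^+ 2 =
      8 * h * (2^-1 * (1 - 2^-1) * ((2 * h)^-1 * mdist v w ^+ 2)).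
    by field; rewrite gt_eqF.
  have -> : 4 * h * (q + r - 2 * m) = 8 * h * ((q + r) / 2 - m) by field.
  by rewrite ler_pM2l ?mulr_gt0//; lra.
have [l ul] : exists l : X, u @ \oo --> l.
  apply: sqr_mdist_cauchy_cvg => e e0.
  have [N _ hN] : \forall n \near \oo, (harmonic n : R) < e / (8 * h).
    by apply: (cvgr_lt _ cvg_harmonic); rewrite divr_gt0// mulr_gt0.
  exists N => i j /hN Ni /hN Nj.
  have [[di hi] [dj hj]] := (hu i, hu j).
  apply: le_lt_trans (u_near _ _ di dj) _.
  have -> : e = 4 * h * (e / (8 * h) + e / (8 * h)) by field; rewrite gt_eqF.
  rewrite ltr_pM2l ?mulr_gt0//; move: hi hj Ni Nj => /=.
  by move: (prox_cost _ _ (u i)) (prox_cost _ _ (u j)) => p q;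
    move: i.+1%:R^-1 j.+1%:R^-1 (e / (8 * h)) => a b c; lra.
have [dl hl] : dom phi l /\ fine (phi l) <= m + 0 - (2 * h)^-1 * mdist x l ^+ 2.
  apply: dom_le_fin; apply: (lower_semicontinuous_cvg_le phi_lsc ul
    (a := fun n => m + harmonic n - (2 * h)^-1 * mdist x (u n) ^+ 2)).
    apply: cvgB; first by apply: cvgD; [exact: cvg_cst | exact: cvg_harmonic].
    rewrite (metric_sym x); under eq_fun do rewrite (metric_sym x).
    by apply: cvgMl_tmp; exact: cvg_sqr_mdist.
  near=> n; have [dn hn] := hu n; rewrite -(fine_domK dn) lee_fin.
  by move: hn; rewrite /prox_cost; lra.
exists l => v; have [dv|] := boolP (phi v < +oo)%E; last first.
  by rewrite -leNgt leye_eq => /eqP ->; rewrite addye// leey.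
rewrite -(fine_domK dv) -(fine_domK dl) -!EFinD lee_fin.
by apply: le_trans (m_le v dv); rewrite /prox_cost; lra.
Unshelve. all: by end_near. Qed.

(** The passage to the limit $t \to 0$ in a first variation, for the affine
    dependence on $t$ that occurs in [resolvent_evi]. *)
Lemma first_variation (a g : R) : 0 <= g ->
  (forall t, 0 < t -> t < 1 -> a + (1 - t) * g <= 0) -> a + g <= 0.
Proof.
move=> g0 H; rewrite leNgt; apply/negP => d0.
have s0 : 0 < a + g + g + 1 by lra.
pose t := (a + g) / (a + g + g + 1).
have tE : t * (a + g + g + 1) = a + g by rewrite /t; field; rewrite gt_eqF.
have t0 : 0 < t by rewrite divr_gt0.
have t1 : t < 1 by rewrite ltr_pdivrMr//; lra.
have := H t t0 t1; nra.
Qed.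

(** The minimizer $w$ is compared with the points of the geodesic from $w$ to
    $v$: strong convexity bounds the cost there, and the derivative at $w$ of
    this bound is the inequality. *)
Lemma resolvent_evi (h : R) (x v : X) : 0 < h -> dom phi v ->
  let w := resolvent phi h x in
  dom phi w /\ mdist w v ^+ 2 + mdist x w ^+ 2
    + 2 * h * (fine (phi w) - fine (phi v)) <= mdist x v ^+ 2.
Proof.
move=> h0 dv w.
have wmin : argmin (fun u => phi u + ((2 * h)^-1 * mdist x u ^+ 2)%:E)%E w.
  by rewrite /w /resolvent h0; apply: getPex; exact: argmin_prox_exists.
have dw : dom phi w.
  have := wmin v; rewrite -(fine_domK dv) -EFinD /dom /= => wv.
  by rewrite ltNge leye_eq; apply/negP => /eqP wE; rewrite wE addye in wv.
split=> //; have [c gc] := hX.1 w v.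
suff : 2 * h * (fine (phi w) - fine (phi v)) + mdist x w ^+ 2 - mdist x v ^+ 2
  + mdist w v ^+ 2 <= 0 by lra.
apply: first_variation => [|t t0 t1]; first exact: sqr_ge0.
have t01 : 0 <= t <= 1 by rewrite !ltW.
have [dc _] := convex_fine gc dw dv t01.
have := wmin (c t); rewrite -(fine_domK dw) -(fine_domK dc) -!EFinD lee_fin.
move=> /le_trans /(_ (prox_cost_geodesic x h0 gc dw dv t01)).
rewrite /prox_cost -(ler_pM2l (_ : 0 < 2 * h)) ?mulr_gt0// => H.
rewrite -(pmulr_rle0 _ t0) -subr_ge0.
move: H; rewrite -subr_ge0; congr (0 <= _); field.
by rewrite gt_eqF.
Qed.

(** * Iterates of resolvents *)

Local Notation J := (resolvent phi).

Lemma dom_iter (h : R) (x : X) (n : nat) : 0 < h -> dom phi x ->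
  dom phi (iter n (J h) x).
Proof.
move=> h0 dx; elim: n => //= n dn.
by case: (resolvent_evi (iter n (J h) x) h0 dx).
Qed.

(** The one-step inequalities with test point $v$ are summed; since the values
    of $\phi$ decrease along the iterates (the one-step inequality with the
    previous iterate as test point), each of them may be replaced by the last
    one. *)
Lemma iter_resolvent_evi (h : R) (x v : X) (n : nat) :
  0 < h -> dom phi x -> dom phi v ->
  mdist (iter n (J h) x) v ^+ 2
    + 2 * (n%:R * h) * (fine (phi (iter n (J h) x)) - fine (phi v))
  <= mdist x v ^+ 2.
Proof.
move=> h0 dx dv; elim: n => [|n IH]; first by rewrite mul0r mulr0 mul0r addr0.
have dn := dom_iter n h0 dx; rewrite iterS.
move: (iter n (J h) x) dn IH => u du IH.
have [_ E1] := resolvent_evi u h0 dv; have [_] := resolvent_evi u h0 du.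
rewrite mdistxx expr0n /= => E2.
have m0 := sqr_ge0 (mdist (J h u) u); have m1 := sqr_ge0 (mdist u (J h u)).
have dec : 2 * h * (fine (phi (J h u)) - fine (phi u)) <= 0 by lra.
have := ler_wpM2l (ler0n R n) dec; rewrite -(natr1 n) => dec'.
apply: le_trans IH; rewrite -subr_ge0.
rewrite mulr0 in dec'; move: E1 dec'.
move: (fine (phi (J h u))) (fine (phi u)) (fine (phi v)) => p q r E1 dec'.
have -> : 2 * ((n%:R + 1) * h) * (p - r) = 2 * h * (p - r) +
  n%:R * (2 * h * (p - q)) + 2 * (n%:R * h) * (q - r) by ring.
lra.
Qed.

(** A comparison principle for the recursion satisfied by the squared distances
    $D_{i,j}$ of two trajectories. The bound is the tangent-line form of
    $2 M \sqrt{G_{i,j}}$, where $M = \phi(x) - \min\phi$: being affine in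
    $G_{i,j}$, it satisfies the recursion with equality. On the boundary,
    $D_{n,0} \le 2 n s M$ with $s$ the step, and $2 n s \le (n s)^2/c + c$. *)
Lemma kobayashi (h k c : R) (x : X) (i j : nat) :
  0 < h -> 0 < k -> 0 < c -> dom phi x ->
  mdist (iter i (J h) x) (iter j (J k) x) ^+ 2 <=
    (fine (phi x) - fine (phi y)) *
    (((i%:R * h - j%:R * k) ^+ 2 + i%:R * h * h + j%:R * k * k) / c + c).
Proof.
move=> h0 k0 c0 dx; set M := _ - _.
have M0 : 0 <= M by rewrite subr_ge0 argmin_le_fine.
have drift (s : R) n : 0 < s -> mdist (iter n (J s) x) x ^+ 2 <=
    M * (((n%:R * s) ^+ 2 + n%:R * s * s) / c + c).
  move=> s0; have dn := dom_iter n s0 dx.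
  have le1 := iter_resolvent_evi n s0 dx dx.
  rewrite mdistxx expr0n /= in le1.
  have nsM : 2 * (n%:R * s) * (fine (phi y)) <=
      2 * (n%:R * s) * fine (phi (iter n (J s) x)).
    by rewrite ler_wpM2l ?argmin_le_fine// !mulr_ge0// ltW.
  apply: (@le_trans _ _ (M * (2 * (n%:R * s)))); first by rewrite /M; lra.
  rewrite ler_wpM2l// -subr_ge0.
  have -> : ((n%:R * s) ^+ 2 + n%:R * s * s) / c + c - 2 * (n%:R * s) =
    ((n%:R * s - c) ^+ 2 + n%:R * s * s) / c by field; rewrite gt_eqF.
  apply: divr_ge0; last exact: ltW.
  by rewrite addr_ge0 ?sqr_ge0// !mulr_ge0// ltW.
elim: i j => [|i IHi] j.
  rewrite metric_sym !mul0r sub0r sqrrN addr0; exact: drift.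
elim: j => [|j IHj]; first by rewrite !mul0r subr0 addr0; exact: drift.
have di := dom_iter i.+1 h0 dx; have dj := dom_iter j.+1 k0 dx.
have [_ Ei] := resolvent_evi (iter i (J h) x) h0 dj.
have [_ Ej] := resolvent_evi (iter j (J k) x) k0 di.
have {}IHi := IHi j.+1.
move: di dj Ei Ej IHi IHj; rewrite -![J _ (iter _ _ _)]iterS.
rewrite (metric_sym (iter j.+1 _ _)) (metric_sym (iter j _ _) (iter i.+1 _ _)).
set D := mdist (iter i.+1 (J h) x) (iter j.+1 (J k) x) ^+ 2.
set p := fine (phi (iter i.+1 (J h) x)).
set q := fine (phi (iter j.+1 (J k) x)).
set Di := mdist (iter i (J h) x) (iter j.+1 (J k) x) ^+ 2.
set Dj := mdist (iter i.+1 (J h) x) (iter j (J k) x) ^+ 2.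
move=> _ _ Ei Ej IHi IHj.
have {}Ei : D + 2 * h * (p - q) <= Di.
  apply: le_trans Ei.
  by have := sqr_ge0 (mdist (iter i (J h) x) (iter i.+1 (J h) x)); lra.
have {}Ej : D + 2 * k * (q - p) <= Dj.
  apply: le_trans Ej.
  by have := sqr_ge0 (mdist (iter j (J k) x) (iter j.+1 (J k) x)); lra.
(* These weights cancel the values of phi. *)
rewrite -(ler_pM2l (_ : 0 < h + k)) ?addr_gt0//.
apply: (@le_trans _ _ (k * Di + h * Dj)).
  have -> : (h + k) * D = k * (D + 2 * h * (p - q)) + h * (D + 2 * k * (q - p))
    by ring.
  by rewrite lerD// ler_pM2l.
apply: le_trans (lerD (ler_wpM2l (ltW k0) IHi) (ler_wpM2l (ltW h0) IHj)) _.
rewrite le_eqVlt; apply/orP; left; apply/eqP; rewrite -!natr1; field.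
by rewrite gt_eqF.
Qed.

(** The choice of $c$ makes $2 M c$ smaller than the target, and
    $G < c^2$ bounds $G/c + c$ by $2c$. *)
Lemma kobayashi_small (x : X) (e : R) : 0 < e -> dom phi x ->
  exists2 d : R, 0 < d & forall (h k : R) (i j : nat), 0 < h -> 0 < k ->
    (i%:R * h - j%:R * k) ^+ 2 + i%:R * h * h + j%:R * k * k < d ->
    mdist (iter i (J h) x) (iter j (J k) x) ^+ 2 < e.
Proof.
move=> e0 dx; pose M := fine (phi x) - fine (phi y).
have M0 : 0 <= M by rewrite subr_ge0 argmin_le_fine.
have M1 : 0 < 2 * (M + 1) by rewrite mulr_gt0 ?ltr_wpDl.
pose c := e / (2 * (M + 1)); have c0 : 0 < c by rewrite divr_gt0.
exists (c ^+ 2) => [|h k i j h0 k0 Gd]; first by rewrite exprn_gt0.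
apply: le_lt_trans (kobayashi _ _ h0 k0 c0 dx) _; rewrite -/M.
apply: (@le_lt_trans _ _ (M * (c + c))).
  by rewrite ler_wpM2l// lerD2r ler_pdivrMr// -expr2 ltW.
have -> : e = 2 * (M + 1) * c by rewrite /c; field; rewrite gt_eqF; lra.
nra.
Qed.

(** * Convergence to the gradient flow *)

(** [N n] steps of size [h n] cover asymptotically the time [t]. The step size
    need not divide [t]. *)
Definition discretization (t : R) (h : nat -> R) (N : nat -> nat) :=
  [/\ \forall n \near \oo, 0 < h n, h @ \oo --> 0 &
      (N n)%:R * h n @[n --> \oo] --> t].

(** The quantity bounds the contribution of one discretization to
    $G_{i,j}$, since $(a-b)^2 \le 2(a-t)^2 + 2(b-t)^2$. *)
Lemma discretization_small t h N (d : R) : discretization t h N -> 0 < d ->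
  \forall n \near \oo,
    0 < h n /\ 2 * ((N n)%:R * h n - t) ^+ 2 + (N n)%:R * h n * h n < d.
Proof.
move=> [h_gt0 h0 Nh] d0; near=> n; split; first by near: n.
near: n; have : 2 * ((N n)%:R * h n - t) ^+ 2 + (N n)%:R * h n * h n
    @[n --> \oo] --> 2 * (t - t) ^+ 2 + t * 0.
  apply: cvgD; last exact: cvgM.
  have Nt : (N n)%:R * h n - t @[n --> \oo] --> t - t.
    by apply: cvgB => //; exact: cvg_cst.
  by apply: cvgMl_tmp; exact: (cvg_comp _ _ Nt (@exprn_continuous _ 2 _)).
rewrite subrr expr0n /= !mulr0 addr0 => H; exact: (cvgr_lt _ H).
Unshelve. all: by end_near. Qed.

Lemma discretizations_close t h N k P (x : X) (e : R) :
  discretization t h N -> discretization t k P -> dom phi x -> 0 < e ->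
  exists n0, forall n m, (n0 <= n)%N -> (n0 <= m)%N ->
    mdist (iter (N n) (J (h n)) x) (iter (P m) (J (k m)) x) ^+ 2 < e.
Proof.
move=> hN kP dx e0; have [d d0 hd] := kobayashi_small e0 dx.
have d2 : 0 < d / 2 by rewrite divr_gt0.
have [n1 _ h1] := discretization_small hN d2.
have [n2 _ h2] := discretization_small kP d2.
exists (maxn n1 n2) => n m; rewrite !geq_max => /andP[nn1 _] /andP[_ mn2].
have [hn0 hn] := h1 n nn1; have [km0 km] := h2 m mn2.
apply: hd => //; move: ((N n)%:R * _) ((P m)%:R * _) hn km => a b.
by have := sqr_ge0 ((a - t) + (b - t)); nra.
Qed.

Lemma cvg_divn (t : R) : t / n%:R @[n --> \oo] --> 0.
Proof.
rewrite -cvg_shiftS.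
have : t * harmonic n @[n --> \oo] --> t * 0.
  by apply: cvgMl_tmp; exact: cvg_harmonic.
by rewrite mulr0.
Qed.

Lemma divn_gt0_near (t : R) : 0 < t -> \forall n \near \oo, 0 < t / n%:R.
Proof. by move=> t0; exists 1 => // n /= n0; rewrite divr_gt0// ltr0n. Qed.

Lemma discretization_uniform (t : R) :
  0 < t -> discretization t (fun n => t / n%:R) id.
Proof.
move=> t0; split; [exact: divn_gt0_near | exact: cvg_divn | ].
apply: cvg_near_cst; exists 1 => // n /= n0.
by rewrite mulrC divfK// pnatr_eq0 -lt0n.
Qed.

(** All discretizations of $t$ have a common limit because any two of them get
    close to each other; the uniform one, which defines the flow, is Cauchy as
    it gets close to itself. *)
Lemma gradient_flow_cvg t h N (x : X) : 0 < t -> discretization t h N ->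
  dom phi x ->
  iter (N n) (J (h n)) x @[n --> \oo] --> gradient_flow phi t x.
Proof.
move=> t0 hN dx; have ht := discretization_uniform t0.
have [l ul] : exists l : X, iter n (J (t / n%:R)) x @[n --> \oo] --> l.
  apply: sqr_mdist_cauchy_cvg => e e0.
  have [n0 hn0] := discretizations_close ht ht dx e0.
  by exists n0.
have -> : gradient_flow phi t x = l.
  by apply: cvg_lim ul; exact: metric_hausdorff.
apply: sqr_mdist_cvg => e e0.
have e2 : 0 < e / 2 by rewrite divr_gt0.
have [n0 hn0] := discretizations_close ht hN dx e2.
exists n0 => // n /= n0n; apply: (@le_lt_trans _ _ (e / 2)); last by lra.
rewrite metric_sym.
apply: (ler_cvg_to (cvg_sqr_mdist ul) (cvg_cst (e / 2))).
by exists n0 => // m /= n0m; rewrite ltW// hn0.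
Qed.

(** The step size $s/n$ reaches $s$ after exactly $n$ steps and $t$, up to one
    step, after $k_n$ more, so that the two points are limits along one and the
    same trajectory and [iter_resolvent_evi] applies between them. *)
Lemma gradient_flow_evi (s t : R) (x v : X) : 0 < s -> s <= t ->
  dom phi x -> dom phi v ->
  mdist (gradient_flow phi t x) v ^+ 2 <=
  mdist (gradient_flow phi s x) v ^+ 2
    + 2 * (t - s) * (fine (phi v) - fine (phi y)).
Proof.
move=> s0 st dx dv; have hs := discretization_uniform s0.
pose h n := s / n%:R; pose k n := Num.truncn ((t - s) / h n).
have kE n : 0 < h n -> (k n)%:R * h n <= t - s < (k n)%:R * h n + h n.
  move=> hn; have ts : 0 <= (t - s) / h n.
    by apply: divr_ge0; rewrite ?subr_ge0// ltW.
  have /andP[k1 k2] := truncn_itv ts; apply/andP; split.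
    by rewrite -ler_pdivlMr.
  have -> : (k n)%:R * h n + h n = (k n).+1%:R * h n.
    by rewrite -(natr1 (k n)); ring.
  by rewrite -ltr_pdivrMr.
have ht : discretization t h (fun n => k n + n)%N.
  split; [exact: divn_gt0_near | exact: cvg_divn | ].
  apply: (@squeeze_cvgr _ _ _ _ (fun n => t - h n) (fun=> t)).
  - exists 1 => // n /= n0; have n0' : 0 < n%:R :> R by rewrite ltr0n.
    have := kE n (divr_gt0 s0 n0').
    rewrite natrD mulrDl.
    have -> : n%:R * h n = s by rewrite /h mulrC divfK// gt_eqF.
    by move=> /andP[k1 k2]; apply/andP; split; lra.
  - have : t - h n @[n --> \oo] --> t - 0.
      by apply: cvgB; [exact: cvg_cst | exact: cvg_divn].
    by rewrite subr0.
  - exact: cvg_cst.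
have t0 : 0 < t by exact: lt_le_trans st.
have rhs_cvg : mdist (iter n (J (h n)) x) v ^+ 2
      + 2 * (t - s) * (fine (phi v) - fine (phi y)) @[n --> \oo] -->
    mdist (gradient_flow phi s x) v ^+ 2
      + 2 * (t - s) * (fine (phi v) - fine (phi y)).
  apply: cvgD; last exact: cvg_cst.
  exact: cvg_sqr_mdist (gradient_flow_cvg s0 hs dx).
apply: (ler_cvg_to (cvg_sqr_mdist (gradient_flow_cvg t0 ht dx)) rhs_cvg).
exists 1 => // n /= n0; have hn : 0 < h n by rewrite divr_gt0// ltr0n.
have dn := dom_iter n hn dx; rewrite iterD.
have E := iter_resolvent_evi (k n) hn dn dv.
have w_ge := argmin_le_fine (dom_iter (k n) hn dn).
have v_ge := argmin_le_fine dv; have /andP[k_le _] := kE n hn.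
have k_ge : 0 <= (k n)%:R * h n by rewrite mulr_ge0// ltW.
have lower : 2 * ((k n)%:R * h n) * (fine (phi y) - fine (phi v)) <=
    2 * ((k n)%:R * h n)
      * (fine (phi (iter (k n) (J (h n)) (iter n (J (h n)) x))) - fine (phi v)).
  by apply: ler_wpM2l; [rewrite mulr_ge0 | rewrite lerD2r].
have upper : 2 * ((k n)%:R * h n) * (fine (phi v) - fine (phi y)) <=
    2 * (t - s) * (fine (phi v) - fine (phi y)).
  by apply: ler_wpM2r; [rewrite subr_ge0 | rewrite ler_wpM2l].
by move: E lower upper; rewrite -/(h n); lra.
Qed.

Lemma gradient_flow_mdist_argmin (t : R) (x : X) : 0 < t -> dom phi x ->
  mdist (gradient_flow phi t x) y <= mdist x y.
Proof.
move=> t0 dx; rewrite -ler_sqr ?nnegrE ?mdist_ge0//.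
have ht := discretization_uniform t0.
apply: (ler_cvg_to (cvg_sqr_mdist (gradient_flow_cvg t0 ht dx)) (cvg_cst _)).
exists 1 => // n /= n0; have hn : 0 < t / n%:R by rewrite divr_gt0// ltr0n.
apply: le_trans (iter_resolvent_evi n hn dx dom_y).
rewrite lerDl mulr_ge0//; last first.
  by rewrite subr_ge0 argmin_le_fine//; exact: dom_iter.
by rewrite !mulr_ge0// ltW.
Qed.

Lemma gradient_flow_energy (t : R) (x : X) : 0 < t -> dom phi x ->
  dom phi (gradient_flow phi t x) /\
  fine (phi (gradient_flow phi t x)) <= fine (phi y) + mdist x y ^+ 2 / (2 * t).
Proof.
move=> t0 dx; apply: dom_le_fin; have ht := discretization_uniform t0.
apply: (lower_semicontinuous_cvg_le phi_lsc (gradient_flow_cvg t0 ht dx)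
  (cvg_cst _)).
exists 1 => // n /= n0; have hn : 0 < t / n%:R by rewrite divr_gt0// ltr0n.
have dn := dom_iter n hn dx; rewrite -(fine_domK dn) lee_fin.
rewrite -lerBlDl ler_pdivlMr ?mulr_gt0// mulrC.
apply: le_trans (iter_resolvent_evi n hn dx dom_y).
have -> : n%:R * (t / n%:R) = t by rewrite mulrC divfK// pnatr_eq0 -lt0n.
by rewrite lerDr sqr_ge0.
Qed.

End resolvents.

(** * The rate and metastability *)

Section rates.
Context {R : realType} (b : nat) (eps : R) (f : nat -> nat).
Context (hf : {homo f : m n / (m <= n)%N}).
Local Notation D := (Delta_rec b eps f).

Lemma Delta_step_ge0 (m : nat) : 0 <= 24 * b%:R ^+ 2 * m%:R / eps ^+ 2.
Proof. by rewrite divr_ge0 ?sqr_ge0// !mulr_ge0// exprn_ge0. Qed.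

Lemma Delta_rec_ge (j : nat) : 0 < eps ->
  24 * b%:R ^+ 2 * (f (D j + 1) + 1)%:R <= (D j.+1)%:R * eps ^+ 2.
Proof.
move=> eps0; rewrite -ler_pdivrMr ?exprn_gt0//=.
set r := _ / _; have r0 : 0 <= r by exact: Delta_step_ge0.
rewrite natr_absz ger0_norm ?ceil_ge//.
by rewrite ceil_ge0 (lt_le_trans _ r0).
Qed.

Lemma Delta_rec_homo : {homo D : i j / (i <= j)%N}.
Proof.
apply: homo_leq => [//|? ? ?|j]; first exact: leq_trans.
elim: j => [|j IH]; first exact: leq0n.
rewrite [in leqLHS]/= [in leqRHS]/= -lez_nat.
rewrite !gez0_abs ?ceil_ge0 ?(lt_le_trans _ (Delta_step_ge0 _))//.
apply: le_ceil; rewrite ler_wpM2r ?invr_ge0 ?sqr_ge0//.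
rewrite ler_wpM2l ?mulr_ge0 ?exprn_ge0// ler_nat leq_add2r.
by apply: hf; rewrite leq_add2r.
Qed.

End rates.

Theorem theorem4p34 (R : realType) (X : completeMetricType R)
    (hX : hadamard X)
    (phi : X -> \bar R)
    (phi_gtNy : forall z, (-oo < phi z)%E)
    (phi_convex : geodesically_convex phi)
    (phi_lsc : lower_semicontinuous phi)
    (y : X) (hy : argmin phi y)
    (x : X) (hx : dom phi x)
    (b : nat) (hb : mdist x y <= b%:R)
    (gamma : R -> nat)
    (hgamma : modulus_of_total_boundedness
                (metric_closed_ball y b%:R `&` closure (dom phi)) gamma)
    (eps : R) (heps : 0 < eps)
    (f : nat -> nat) (hf : {homo f : m n / (m <= n)%N}) :
  exists n : nat, (n <= Delta b gamma eps f)%N /\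
    forall s t : R,
      n%:R <= s <= (n + f n)%:R -> n%:R <= t <= (n + f n)%:R ->
      mdist (gradient_flow phi t x) (gradient_flow phi s x) <= eps.
Proof.
have dy : dom phi y by exact: le_lt_trans (hy x) hx.
pose N k := (Delta_rec b eps f k + 1)%N.
pose S t := gradient_flow phi t x.
have N0 k : 0 < (N k)%:R :> R by rewrite ltr0n /N addn1.
have energy k :=
  gradient_flow_energy hX phi_gtNy phi_convex phi_lsc hy dy (N0 k) hx.
have r12 : 0 < Num.sqrt (12 : R) by rewrite sqrtr_gt0.
have SX0 k : (metric_closed_ball y b%:R `&` closure (dom phi)) (S (N k)%:R).
  split; last by apply: subset_closure; exact: (energy k).1.
  rewrite /metric_closed_ball /= metric_sym; apply: le_trans hb.
  exact: (gradient_flow_mdist_argmin hX phi_gtNy phi_convex phi_lsc hy dy).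
have [i [j [ij jg dij]]] :=
  hgamma _ (fun k => S (N k)%:R) (divr_gt0 heps r12) SX0.
exists (N i); split.
  rewrite /N /Delta leq_add2r; apply: (Delta_rec_homo b eps hf).
  by rewrite addn1 (leq_trans (ltnW ij))// (leq_trans jg).
have near_Sj t : (N i)%:R <= t <= (N i + f (N i))%:R ->
    mdist (S t) (S (N j)%:R) <= eps / 2.
  move=> /andP[it ti]; have [dj ej] := energy j.
  have := gradient_flow_evi hX phi_gtNy phi_convex phi_lsc hy dy
    (N0 i) it hx dj.
  rewrite -/(S _) -/(S _) => evi.
  have e2 : 0 <= eps / 2 by rewrite divr_ge0// ltW.
  rewrite -ler_sqr ?nnegrE ?mdist_ge0//; apply: le_trans evi _.
  have dij2 : mdist (S (N i)%:R) (S (N j)%:R) ^+ 2 <= eps ^+ 2 / 12.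
    have -> : eps ^+ 2 / 12 = (eps / Num.sqrt 12) ^+ 2.
      by rewrite expr_div_n sqr_sqrtr.
    have e12 : 0 <= eps / Num.sqrt 12 by rewrite ltW// divr_gt0.
    by rewrite ler_sqr ?nnegrE ?mdist_ge0.
  have b2 : mdist x y ^+ 2 <= b%:R ^+ 2 by rewrite ler_sqr ?nnegrE ?mdist_ge0.
  have tN : t - (N i)%:R <= (f (N i))%:R by move: ti; rewrite natrD; lra.
  have NE : 24 * b%:R ^+ 2 * ((f (N i))%:R + 1) <= (N j)%:R * eps ^+ 2.
    have := Delta_rec_ge b f i heps; rewrite natrD => /le_trans; apply.
    rewrite ler_wpM2r ?sqr_ge0// ler_nat /N addn1 ltnW// ltnS.
    exact: (Delta_rec_homo b eps hf).
  have gap : fine (phi (S (N j)%:R)) - fine (phi y)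
      <= b%:R ^+ 2 / (2 * (N j)%:R).
    rewrite lerBlDl; apply: le_trans ej _.
    by rewrite lerD2l ler_wpM2r// invr_ge0 mulr_ge0// ltW.
  have gap_f : 2 * (f (N i))%:R * (b%:R ^+ 2 / (2 * (N j)%:R)) <= eps ^+ 2 / 24.
    have -> : 2 * (f (N i))%:R * (b%:R ^+ 2 / (2 * (N j)%:R)) =
        (f (N i))%:R * b%:R ^+ 2 / (N j)%:R :> R by field; rewrite gt_eqF.
    rewrite ler_pdivrMr//.
    by have := sqr_ge0 (b%:R : R); lra.
  have gap0 : 0 <= b%:R ^+ 2 / (2 * (N j)%:R) :> R.
    by rewrite divr_ge0 ?sqr_ge0// mulr_ge0// ltW.
  have f0 : 0 <= (f (N i))%:R :> R by [].
  have ti0 : 0 <= t - (N i)%:R by rewrite subr_ge0.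
  have gap_t : 2 * (t - (N i)%:R)
      * (fine (phi (S (N j)%:R)) - fine (phi y)) <= eps ^+ 2 / 24.
    apply: le_trans gap_f.
    apply: (@le_trans _ _ (2 * (t - (N i)%:R) * (b%:R ^+ 2 / (2 * (N j)%:R)))).
      by rewrite ler_wpM2l// mulr_ge0.
    by rewrite ler_wpM2r// ler_wpM2l.
  have := sqr_ge0 eps.
  have -> : (eps / 2) ^+ 2 = eps ^+ 2 / 4 by field.
  move: dij2 gap_t; rewrite /S; lra.
move=> s t hs ht; apply: le_trans (metric_triangle _ (S (N j)%:R) _) _.
rewrite (metric_sym (S _)) [leRHS]splitr.
by apply: lerD; exact: near_Sj.
Qed.
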